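(* Let $X\in\mathbb R^{n\times p}$ be fixed, let $\mathbf y\in\mathbb R^n$ be a random vector with independent components satisfying, for some $\sigma\ge0$, $\mathbb E\,e^{t(\mathbf y_i-\mathbb E\mathbf y_i)}\le e^{\sigma^2t^2/2}$ for all $i$ and all $t\in\mathbb R$, and let $\hat Q(\beta)=\|X\beta-\mathbf y\|_2^2$. Let $\mathrm{cl}$ be a coding length with coding complexity $c(\cdot)$. Fix a target $\bar\beta\in\mathbb R^p$ and $\eta\in(0,1)$. Then with probability exceeding $1-\eta$, for all $\epsilon\ge0$ and all $\hat\beta\in\mathbb R^p$ such that $\hat Q(\hat\beta)\le\hat Q(\bar\beta)+\epsilon$, we have \[ \|X\hat\beta-\mathbb E\mathbf y\|_2\le\|X\bar\beta-\mathbb E\mathbf y\|_2+\sigma\sqrt{2\ln(6/\eta)}+2\left(7.4\sigma^2c(\hat\beta)+4.7\sigma^2\ln(6/\eta)+\epsilon\right)^{1/2}. \] Moreover, if the coding complexity $c(\cdot)$ is sub-additive, then (on the same event) \[ n\,\rho_-(c(\hat\beta)+c(\bar\beta))\,\|\hat\beta-\bar\beta\|_2^2\le 10\|X\bar\beta-\mathbb E\mathbf y\|_2^2+37\sigma^2c(\hat\beta)+29\sigma^2\ln(6/\eta)+2.5\epsilon. \]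
   Context: Let $\mathcal I=\{1,\ldots,p\}$ and $\mathrm{supp}(\beta)=\{j:\beta_j\ne0\}$. A function $\mathrm{cl}$ from subsets of $\mathcal I$ to $[0,\infty]$ is a coding length if $\sum_{F\subset\mathcal I,\,F\ne\emptyset}2^{-\mathrm{cl}(F)}\le1$, with $\mathrm{cl}(\emptyset)=0$. The coding complexity is $c(F)=|F|+\mathrm{cl}(F)$ for $F\subset\mathcal I$, and $c(\beta)=\min\{c(F):\mathrm{supp}(\beta)\subset F\}$ for $\beta\in\mathbb R^p$. It is sub-additive if $c(F\cup F')\le c(F)+c(F')$ for all $F,F'\subset\mathcal I$. For $F\subset\mathcal I$, $\rho_-(F)=\inf\{\frac1n\|X\beta\|_2^2/\|\beta\|_2^2:\beta\ne0,\ \mathrm{supp}(\beta)\subset F\}$, and for $s>0$, $\rho_-(s)=\inf\{\rho_-(F):F\subset\mathcal I,\ c(F)\le s\}$. *)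

(* Defs.v *)
From HB Require Import structures.
From mathcomp Require Import all_boot all_order all_algebra.
From mathcomp Require Import all_classical all_reals all_analysis.
Set Implicit Arguments. Unset Strict Implicit. Unset Printing Implicit Defensive.
Import Order.TTheory GRing.Theory Num.Theory.
Local Open Scope classical_set_scope.
Local Open Scope ring_scope.

Definition norm2 (R : realType) (m : nat) (v : 'cV[R]_m) : R :=
  Num.sqrt (\sum_(i < m) v i 0 ^+ 2).

Definition supp (R : realType) (p : nat) (b : 'cV[R]_p) : {set 'I_p} :=
  [set j | b j 0 != 0].

Definition pow2neg (R : realType) (x : \bar R) : R :=
  match x with
  | EFin r => expR (- r * ln 2)
  | _ => 0
  end.

Definition coding_length (R : realType) (p : nat) (cl : {set 'I_p} -> \bar R) : Prop :=
  [/\ cl (@finset.set0 _) = 0%E,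
      (forall F, (0 <= cl F)%E) &
      \sum_(F : {set 'I_p} | F != @finset.set0 _) pow2neg (cl F) <= 1].

Definition cc_set (R : realType) (p : nat) (cl : {set 'I_p} -> \bar R)
  (F : {set 'I_p}) : \bar R := ((#|F|%:R : R)%:E + cl F)%E.

Definition cc (R : realType) (p : nat) (cl : {set 'I_p} -> \bar R)
  (b : 'cV[R]_p) : \bar R :=
  \big[Order.min/+oo%E]_(F : {set 'I_p} | supp b \subset F) cc_set cl F.

Definition cc_subadditive (R : realType) (p : nat) (cl : {set 'I_p} -> \bar R) : Prop :=
  forall F F' : {set 'I_p}, (cc_set cl (F :|: F') <= cc_set cl F + cc_set cl F')%E.

(* rho_-(F) = inf { (1/n)||X b||^2 / ||b||^2 : b <> 0, supp b ⊆ F }  (inf of empty = +oo) *)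
Definition rho_minus_set (R : realType) (n p : nat) (X : 'M[R]_(n, p))
  (F : {set 'I_p}) : \bar R :=
  ereal_inf [set ((n%:R)^-1 * norm2 (X *m b) ^+ 2 / norm2 b ^+ 2)%:E
            | b in [set b : 'cV[R]_p | b != 0 /\ supp b \subset F]].

Definition rho_minus (R : realType) (n p : nat) (X : 'M[R]_(n, p))
  (cl : {set 'I_p} -> \bar R) (s : \bar R) : \bar R :=
  ereal_inf [set rho_minus_set X F | F in [set F : {set 'I_p} | (cc_set cl F <= s)%E]].

Definition mutually_independent (d : measure_display) (T : measurableType d)
  (R : realType) (P : probability T R) (n : nat) (y : 'I_n -> T -> R) : Prop :=
  forall B : 'I_n -> set R, (forall i, measurable (B i)) ->
    P (\bigcap_(i in [set: 'I_n]) (y i @^-1` B i)) =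
    (\prod_(i < n) P (y i @^-1` B i))%E.

(* Main.v *)
Require Import Defs.
From HB Require Import structures.
From mathcomp Require Import all_boot all_order all_algebra.
From mathcomp Require Import all_classical all_reals all_analysis.
From mathcomp Require Import measurable_realfun ring lra.
Import Order.TTheory GRing.Theory Num.Theory.
Import numFieldNormedType.Exports.
Import HBNNSimple.
Local Open Scope classical_set_scope.
Local Open Scope ring_scope.

(**
Write [xi = y - E y], [u = X b - E y], [v = X betabar - E y] and [L = ln (6 / eta)].
Expanding [Qhat b <= Qhat betabar + eps] gives
[|u|^2 <= |v|^2 + 2 <u - v, xi> + eps].  If [F] is an optimal support for [b], then
[u] and [u - v] lie in the span of the columns of [X] in [F], of [E y] and of
[X betabar], whose dimension is at most [|F| + 2]; so [<u, xi>] and [<u - v, xi>] are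
controlled by the norm [A_F] of the projection of [xi] on that span.

Independence gives [E exp <l, xi> <= exp (sigma^2 |l|^2 / 2)], and averaging [l] over
Gaussian directions turns this into [E exp (A_F^2 / (4 sigma^2)) <= 2^(dim / 2)].
By Markov and the Kraft inequality for [cl], all the bounds
[A_F^2 <= sigma^2 (5 c(F) + 4 L)] hold simultaneously except on an event of
probability [4 exp (- L)]; the linear term [- <v, xi>] costs another [exp (- L)], for
a total of [5 eta / 6 < eta].
*)

(** * Exponential moments of independent subgaussian variables *)

(** The factorisation passes from indicators to [f] by linearity over simple functions and monotone
    convergence. It serves to peel one variable off a product: [W] is the product of the other
    factors and [C] the product of their means. *)
Lemma integral_weighted_comp (R : realType) (d : measure_display)
  (T : measurableType d) (P : probability T R) (Y : {RV P >-> R})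
  (W : T -> R) (C : R) (f : R -> R) :
  measurable_fun setT W -> (forall w, 0 <= W w) -> 0 <= C ->
  (forall B, measurable B ->
     (\int[P]_w (\1_B (Y w) * W w)%:E = C%:E * P (Y @^-1` B))%E) ->
  measurable_fun setT f -> (forall x, 0 <= f x) ->
  (\int[P]_w (f (Y w) * W w)%:E = C%:E * \int[P]_w (f (Y w))%:E)%E.
Proof.
move=> mW W0 C0 HB mf f0.
have mEf : measurable_fun setT (EFin \o f) by exact/measurable_EFinP.
pose h := nnsfun_approx measurableT mEf.
have cvgh x : ((EFin \o h^~ x) @ \oo --> (f x)%:E)%E.
  by apply: (cvg_nnsfun_approx measurableT mEf) => // ? _; rewrite lee_fin.
have mhY n : measurable_fun setT (fun w => h n (Y w)) by exact: measurableT_comp.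
have cvgM (g : (T -> R)^nat) (G : T -> R) : (forall n, measurable_fun setT (g n)) ->
    (forall n w, 0 <= g n w) -> (forall w, {homo g ^~ w : a b / (a <= b)%N >-> a <= b}) ->
    (forall w, ((g n w)%:E @[n --> \oo] --> (G w)%:E)%E) ->
    ((\int[P]_w (g n w)%:E) @[n --> \oo] --> \int[P]_w (G w)%:E)%E.
  move=> mg g0 ndg gG.
  rewrite (_ : (\int[P]_w (G w)%:E = \int[P]_w limn (fun n => (g n w)%:E))%E).
    apply: (@cvg_monotone_convergence _ _ _ P setT measurableT
      (fun n w => (g n w)%:E)) => //.
    - by move=> n; apply/measurable_EFinP.
    - by move=> n w _; rewrite lee_fin.
    - by move=> w _ a b ab; rewrite lee_fin; exact: ndg.
  by apply: eq_integral => w _; apply/esym/cvg_lim => //; exact: gG.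
have ndh x : {homo (h^~ x) : a b / (a <= b)%N >-> a <= b}.
  by move=> a b ab; apply/lefP; exact: (nd_nnsfun_approx measurableT mEf).
have cvgL : ((\int[P]_w (h n (Y w) * W w)%:E) @[n --> \oo] -->
             \int[P]_w (f (Y w) * W w)%:E)%E.
  apply: cvgM => [n|n w|w a b ab|w].
  - exact: measurable_funM.
  - by rewrite mulr_ge0.
  - by rewrite ler_wpM2r// ndh.
  - by under eq_fun do rewrite EFinM; rewrite EFinM; apply: cvgeZr => //; exact: cvgh.
have cvgR : ((\int[P]_w (h n (Y w))%:E) @[n --> \oo] -->
             \int[P]_w (f (Y w))%:E)%E.
  by apply: cvgM => // w; exact: cvgh.
have cvgR' : ((C%:E * \int[P]_w (h n (Y w))%:E) @[n --> \oo] -->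
             C%:E * \int[P]_w (f (Y w))%:E)%E.
  by apply: cvgeZl => //; exact: cvgR.
suff hE n : (\int[P]_w (h n (Y w) * W w)%:E = C%:E * \int[P]_w (h n (Y w))%:E)%E.
  rewrite -(cvg_lim _ cvgL)// -(cvg_lim _ cvgR')//.
  by under eq_fun do rewrite hE.
have mind r : measurable (h n @^-1` [set r]) by [].
have mindY r : measurable_fun setT (fun w : T => \1_(h n @^-1` [set r]) (Y w) : R).
  by apply: measurableT_comp => //; exact: measurable_indic.
(* A negative [r] is not a value of [h n], so its level set is empty; the sign thus holds for every
   [r], as the exchange of sum and integral asks. *)
have ge0 r w : 0 <= r * \1_(h n @^-1` [set r]) (Y w).
  have [<-|ne] := eqVneq (h n (Y w)) r; first by rewrite mulr_ge0// indicE.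
  by rewrite indicE memNset ?mulr0//= => /eqP; rewrite (negbTE ne).
have range0 r : r \in range (h n) -> 0 <= r.
  by rewrite inE => -[x _ <-].
transitivity (\sum_(r \in range (h n))
  (\int[P]_w (r%:E * (\1_(h n @^-1` [set r]) (Y w) * W w)%:E)))%E.
  rewrite -ge0_integral_fsum//.
  - apply: eq_integral => w _; rewrite fimfunE.
    transitivity (((\sum_(y \in range (h n)) (y * \1_(h n @^-1` [set y]) (Y w))%R%:E) * (W w)%:E)%E).
      by rewrite fsumEFin.
    rewrite ge0_mule_fsuml; last by move=> i; rewrite lee_fin.
    by apply: eq_fsbigr => i _; rewrite -!EFinM mulrA.
  - move=> r; apply/measurable_EFinP; apply: measurable_funM => //.
    exact: measurable_funM.
  - by move=> r w _; rewrite -EFinM lee_fin mulrA mulr_ge0.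
transitivity (C%:E * (\sum_(r \in range (h n))
  (\int[P]_w (r%:E * (\1_(h n @^-1` [set r]) (Y w))%:E))))%E; last first.
  congr (_ * _)%E; rewrite -ge0_integral_fsum//.
  - by apply: eq_integral => w _; rewrite fimfunE -fsumEFin.
  - by move=> r; apply/measurable_EFinP; apply: measurable_funM.
  - by move=> r w _; rewrite -EFinM lee_fin.
rewrite ge0_mule_fsumr; last first.
  by move=> r; apply: integral_ge0 => w _; rewrite -EFinM lee_fin.
apply: eq_fsbigr => r rr.
have r0 : (0 <= r%:E)%E by rewrite lee_fin range0.
rewrite ge0_integralZl//; first last.
- by move=> w _; rewrite lee_fin mulr_ge0// indicE.
- by apply/measurable_EFinP; apply: measurable_funM.
rewrite ge0_integralZl//; first last.
- exact/measurable_EFinP.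
rewrite HB// muleCA; congr (_ * (_ * _))%E.
have mYr : measurable (Y @^-1` (h n @^-1` [set r])).
  by rewrite -[X in measurable X]setTI; exact: (measurable_funP Y).
by have := integral_indic P measurableT mYr; rewrite setIT.
Qed.

(** Independence of events is the case where all factors are indicators. Induction on [k] lets the
    factors of index below [k] be arbitrary while the others stay indicators; each step frees one
    more factor. *)
Lemma independent_integral_prod (R : realType) (d : measure_display)
  (T : measurableType d) (P : probability T R) (n : nat)
  (Y : 'I_n -> {RV P >-> R}) (g : 'I_n -> R -> R) :
  mutually_independent P (fun i => (Y i : T -> R)) ->
  (forall i, measurable_fun setT (g i)) -> (forall i x, 0 <= g i x) ->
  (forall i, (\int[P]_w (g i (Y i w))%:E < +oo)%E) ->
  (\int[P]_w (\prod_(i < n) g i (Y i w))%:E =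
   \prod_(i < n) \int[P]_w (g i (Y i w))%:E)%E.
Proof.
move=> indY.
suff main k : forall g : 'I_n -> R -> R,
    (forall i, measurable_fun setT (g i)) -> (forall i x, 0 <= g i x) ->
    (forall i, (\int[P]_w (g i (Y i w))%:E < +oo)%E) ->
    (forall i : 'I_n, (k <= i)%N -> exists2 B, measurable B & g i = \1_B) ->
    (\int[P]_w (\prod_(i < n) g i (Y i w))%:E =
     \prod_(i < n) \int[P]_w (g i (Y i w))%:E)%E.
  move=> mg g0 goo; apply: (main n) => // i.
  by rewrite leqNgt ltn_ord.
have mYB i B : measurable B -> measurable (Y i @^-1` B).
  by move=> mB; rewrite -[X in measurable X]setTI; exact: (measurable_funP (Y i)).
have intind i B : measurable B -> (\int[P]_w (\1_B (Y i w))%:E = P (Y i @^-1` B))%E.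
  by move=> mB; have := integral_indic P measurableT (mYB i B mB); rewrite setIT.
elim: k => [|k IH] {}g mg g0 goo gB.
  have {gB} /choice [B gB] : forall i, exists B, measurable B /\ g i = \1_B.
    by move=> i; have [//|B mB gE] := gB i; exists B.
  transitivity (P (\bigcap_(i in [set: 'I_n]) (Y i @^-1` B i))); last first.
    rewrite indY => [|i]; last by have [] := gB i.
    by apply: eq_bigr => i _; have [mB ->] := gB i; rewrite intind.
  have mI : measurable (\bigcap_(i in [set: 'I_n]) (Y i @^-1` B i)).
    by apply: fin_bigcap_measurable => // i _; apply: mYB; have [] := gB i.
  rewrite -[in RHS](setIT (\bigcap_(i in _) _)) -integral_indic//.
  apply: eq_integral => w _; congr (_%:E).
  rewrite indicE; case: (boolP (w \in _)) => [|nin].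
    rewrite inE => wI; apply: big1 => i _; have [_ ->] := gB i.
    by rewrite indicE mem_set//; exact: wI.
  have [i wi] : exists i, ~ B i (Y i w).
    apply: contrapT => /forallNP H; move/negP: nin; apply; rewrite inE => i _ /=.
    exact: contrapT (H i).
  rewrite (bigD1 i)//=; have [_ ->] := gB i.
  by rewrite indicE memNset// mul0r.
have [kn|nk] := ltnP k n; last first.
  by apply: IH => // i; rewrite leqNgt (leq_trans (ltn_ord i))// .
pose j := Ordinal kn.
have fing i : (\int[P]_w (g i (Y i w))%:E)%E \is a fin_num.
  by rewrite ge0_fin_numE ?goo//; apply: integral_ge0 => w _; rewrite lee_fin.
pose C := \prod_(i < n | i != j) fine (\int[P]_w (g i (Y i w))%:E)%E.
have CE : (\prod_(i < n | i != j) \int[P]_w (g i (Y i w))%:E)%E = C%:E.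
  rewrite /C; elim/big_ind2: _ => // [x x' y y' -> ->//|i _].
  by rewrite fineK.
have mgY i : measurable_fun setT (fun w => g i (Y i w)) by exact: measurableT_comp.
pose W w := \prod_(i < n | i != j) g i (Y i w).
have mW : measurable_fun setT W.
  rewrite /W; under eq_fun do rewrite -big_filter.
  exact: measurable_prod.
rewrite [RHS](bigD1 j)//= CE muleC -(@integral_weighted_comp R d T P (Y j) W C)//.
- by apply: eq_integral => w _; rewrite (bigD1 j).
- by move=> w; apply: prodr_ge0 => i _.
- apply: prodr_ge0 => i _; apply: fine_ge0.
  by apply: integral_ge0 => w _; rewrite lee_fin.
move=> B mB.
(* Putting [\1_B] in place of the [j]-th factor leaves only indicators from index [k] on, so the
   induction hypothesis applies. *)
pose g' i := if i == j then \1_B else g i.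
transitivity (\int[P]_w (\prod_(i < n) g' i (Y i w))%:E)%E.
  apply: eq_integral => w _; rewrite (bigD1 j)//= {1}/g' eqxx; congr ((_ * _)%:E).
  by apply: eq_bigr => i /negbTE ij; rewrite /g' ij.
rewrite IH.
- rewrite (bigD1 j)//= {1}/g' eqxx intind// muleC -CE; congr (_ * _)%E.
  by apply: eq_bigr => i /negbTE ij; rewrite /g' ij.
- by move=> i; rewrite /g'; case: eqP => // _; exact: measurable_indic.
- by move=> i x; rewrite /g'; case: eqP => // _; rewrite indicE.
- move=> i; rewrite /g'; case: eqP => // _; rewrite intind//.
  by rewrite (le_lt_trans (probability_le1 _ _)) ?ltry//; exact: mYB.
- move=> i ki; rewrite /g'; case: eqP => [_|/eqP ij]; first by exists B.
  apply: gB; rewrite ltn_neqAle ki andbT; apply: contra ij => /eqP kE.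
  by apply/eqP/val_inj.
Qed.

Lemma independent_subgaussian_mgf (R : realType) (d : measure_display)
  (T : measurableType d) (P : probability T R) (n : nat)
  (Y : 'I_n -> {RV P >-> R}) (m : 'I_n -> R) (s : R) (l : 'cV[R]_n) :
  mutually_independent P (fun i => (Y i : T -> R)) ->
  (forall (i : 'I_n) (t : R), (\int[P]_w (expR (t * (Y i w - m i)))%:E
       <= (expR (s ^+ 2 * t ^+ 2 / 2))%:E)%E) ->
  (\int[P]_w (expR (\sum_i l i 0 * (Y i w - m i)))%:E <=
    (expR (s ^+ 2 * (\sum_i l i 0 ^+ 2) / 2))%:E)%E.
Proof.
move=> indY subg.
under eq_integral do rewrite expR_sum.
rewrite (@independent_integral_prod _ _ _ _ _ _ (fun i x => expR (l i 0 * (x - m i))))//.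
- rewrite mulr_sumr mulr_suml expR_sum -prodEFin.
  suff /andP[] : ((0 <= \prod_(i < n) \int[P]_w (expR (l i 0 * (Y i w - m i)))%:E) &&
    (\prod_(i < n) \int[P]_w (expR (l i 0 * (Y i w - m i)))%:E <=
     \prod_(i < n) (expR (s ^+ 2 * l i 0 ^+ 2 / 2))%:E))%E by [].
  elim/big_ind2: _ => [|x x' y y' /andP[? ?] /andP[? ?]|i _].
  + by rewrite lee01 lexx.
  + by rewrite mule_ge0//= lee_pmul.
  + by rewrite subg andbT; apply: integral_ge0 => w _; rewrite lee_fin expR_ge0.
- move=> i; apply: measurableT_comp => //; apply: measurable_funM => //.
  exact: measurable_funB.
- by move=> i; rewrite (le_lt_trans (subg i (l i 0)))// ltry.
Qed.

(** * Inner product and orthonormal families *)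

Definition dot {R : realType} {n : nat} (u v : 'cV[R]_n) : R :=
  \sum_i u i 0 * v i 0.

Lemma dotC {R : realType} {n : nat} (u v : 'cV[R]_n) : dot u v = dot v u.
Proof. by apply: eq_bigr => i _; rewrite mulrC. Qed.

Lemma dotDl {R : realType} {n : nat} (u v w : 'cV[R]_n) :
  dot (u + v) w = dot u w + dot v w.
Proof. by rewrite -big_split; apply: eq_bigr => i _; rewrite mxE mulrDl. Qed.

Lemma dotZl {R : realType} {n : nat} a (u w : 'cV[R]_n) : dot (a *: u) w = a * dot u w.
Proof. by rewrite mulr_sumr; apply: eq_bigr => i _; rewrite mxE mulrA. Qed.

Lemma dotDr {R : realType} {n : nat} (u v w : 'cV[R]_n) :
  dot w (u + v) = dot w u + dot w v.
Proof. by rewrite dotC dotDl !(dotC w). Qed.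

Lemma dotZr {R : realType} {n : nat} a (u w : 'cV[R]_n) : dot w (a *: u) = a * dot w u.
Proof. by rewrite dotC dotZl dotC. Qed.

Lemma dotNr {R : realType} {n : nat} (u w : 'cV[R]_n) : dot w (- u) = - dot w u.
Proof. by rewrite -scaleN1r dotZr mulN1r. Qed.

Lemma dotNl {R : realType} {n : nat} (u w : 'cV[R]_n) : dot (- u) w = - dot u w.
Proof. by rewrite dotC dotNr dotC. Qed.

Lemma dot0r {R : realType} {n : nat} (u : 'cV[R]_n) : dot u 0 = 0.
Proof. by rewrite -(scale0r 0) dotZr mul0r. Qed.

Lemma dot_sumr {R : realType} {n : nat} (I : Type) (r : seq I) (Q : pred I)
    (F : I -> 'cV[R]_n) u :
  dot u (\sum_(i <- r | Q i) F i) = \sum_(i <- r | Q i) dot u (F i).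
Proof. by elim/big_rec2: _ => [|i x y _ <-]; rewrite ?dot0r ?dotDr. Qed.

Lemma dot_ge0 {R : realType} {n : nat} (u : 'cV[R]_n) : 0 <= dot u u.
Proof. by apply: sumr_ge0 => i _; rewrite -expr2 sqr_ge0. Qed.

Lemma dot_eq0 {R : realType} {n : nat} (u : 'cV[R]_n) : (dot u u == 0) = (u == 0).
Proof.
apply/idP/eqP => [|->]; last by rewrite dot0r.
rewrite psumr_eq0 => [|i _]; last by rewrite -expr2 sqr_ge0.
move=> /allP uu; apply/matrixP => i j; rewrite (ord1 j) mxE.
by have := uu i (mem_index_enum i); rewrite /= -expr2 sqrf_eq0 => /eqP.
Qed.

Definition orthonormal_seq {R : realType} {n : nat} (us : seq 'cV[R]_n) : bool :=
  pairwise (fun u v => dot u v == 0) us && all (fun u => dot u u == 1) us.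

Lemma dotBB {R : realType} {n : nat} (u v : 'cV[R]_n) :
  dot (u - v) (u - v) = dot u u - 2 * dot u v + dot v v.
Proof. by rewrite !dotDl !dotDr !dotNl !dotNr (dotC v u); lra. Qed.

(** For an orthonormal [us] this is membership in the span: [x] equals its own orthogonal
    projection. In this form closure under linear combinations follows from linearity of [dot]
    alone. *)
Definition spans {R : realType} {n : nat} (us : seq 'cV[R]_n) (x : 'cV[R]_n) : Prop :=
  x = \sum_(u <- us) dot x u *: u.

Lemma dot_sum_orthonormal {R : realType} {n : nat} (us : seq 'cV[R]_n)
    (a : 'cV[R]_n -> R) (v : 'cV[R]_n) :
  orthonormal_seq us -> v \in us -> dot v (\sum_(u <- us) a u *: u) = a v.
Proof.
elim: us => // u us IH; rewrite /orthonormal_seq/=.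
move=> /andP[/andP[uus pus] /andP[/eqP uu nus]]; rewrite inE big_cons dotDr dotZr.
move=> /orP[/eqP ->|vus].
  rewrite uu mulr1 dot_sumr big_seq big1 ?addr0// => w wus.
  by rewrite dotZr (eqP (allP uus w wus)) mulr0.
by rewrite dotC (eqP (allP uus v vus)) mulr0 add0r IH// /orthonormal_seq pus.
Qed.

(** The residual of each new vector is normalised and added, or dropped when it is 0; hence only an
    upper bound on the size. *)
Lemma gram_schmidt {R : realType} {n : nat} (xs : seq 'cV[R]_n) :
  exists us : seq 'cV[R]_n, [/\ orthonormal_seq us, (size us <= size xs)%N &
    forall x, x \in xs -> spans us x].
Proof.
elim: xs => [|x xs [us [ous sus spus]]]; first by exists [::].
pose y := x - \sum_(u <- us) dot x u *: u.
have xE : x = y + \sum_(u <- us) dot x u *: u by rewrite subrK.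
have yus u : u \in us -> dot u y = 0.
  by move=> uus; rewrite dotDr dotNr dot_sum_orthonormal// (dotC u) subrr.
have [y0|y0] := eqVneq y 0.
  exists us; split => //; first exact: leqW.
  move=> z; rewrite inE => /orP[/eqP ->|]; last exact: spus.
  by rewrite /spans {1}xE y0 add0r.
have dy : 0 < dot y y by rewrite lt0r dot_eq0 y0 dot_ge0.
pose s := Num.sqrt (dot y y).
have s0 : s != 0 by rewrite gt_eqF// sqrtr_gt0.
have s2 : dot y y = s ^+ 2 by rewrite sqr_sqrtr// ltW.
exists (s^-1 *: y :: us); split => //.
  rewrite /orthonormal_seq/=; move: ous => /andP[-> ->]; rewrite !andbT.
  apply/andP; split.
    by apply/allP => u uus; rewrite dotZl dotC yus// mulr0.
  by rewrite dotZl dotZr s2 expr2 mulKf// mulVf.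
(* Vectors already spanned are orthogonal to the residual [y], so the enlarged family only adds a
   zero term to their expansion. *)
have dus z : spans us z -> dot z y = 0.
  move=> ->; rewrite dotC dot_sumr big_seq big1// => u uus.
  by rewrite dotZr (dotC y) yus// mulr0.
move=> z; rewrite /spans inE big_cons => /orP[/eqP ->|/spus zus].
  rewrite {1}xE dotZr; congr (_ + _); rewrite {1}xE dotDl s2.
  rewrite [X in _ + X]dotC dot_sumr big_seq big1 ?addr0; last first.
    by move=> u uus; rewrite dotZr (dotC y) yus// mulr0.
  by rewrite scalerA expr2 mulKf// divff// scale1r.
by rewrite dotZr dus// mulr0 scale0r add0r.
Qed.

Lemma spansD {R : realType} {n : nat} (us : seq 'cV[R]_n) (x y : 'cV[R]_n) :
  spans us x -> spans us y -> spans us (x + y).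
Proof.
rewrite /spans => xE yE; rewrite {1}xE {1}yE -big_split; apply: eq_bigr => u _.
by rewrite dotDl scalerDl.
Qed.

Lemma spansZ {R : realType} {n : nat} (us : seq 'cV[R]_n) (a : R) (x : 'cV[R]_n) :
  spans us x -> spans us (a *: x).
Proof.
rewrite /spans => xE; rewrite {1}xE scaler_sumr; apply: eq_bigr => u _.
by rewrite dotZl scalerA.
Qed.

Lemma spansB {R : realType} {n : nat} (us : seq 'cV[R]_n) (x y : 'cV[R]_n) :
  spans us x -> spans us y -> spans us (x - y).
Proof. by move=> sx sy; rewrite -scaleN1r; apply/spansD/spansZ. Qed.

Lemma spans_mulmx {R : realType} {n p : nat} (X : 'M[R]_(n, p)) (F : {set 'I_p})
    (us : seq 'cV[R]_n) (b : 'cV[R]_p) :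
  (forall j, j \in F -> spans us (col j X)) -> supp b \subset F ->
  spans us (X *m b).
Proof.
move=> sX /fintype.subsetP bF.
have -> : X *m b = \sum_j b j 0 *: col j X.
  apply/matrixP => i k; rewrite (ord1 k) !mxE summxE; apply: eq_bigr => j _.
  by rewrite !mxE mulrC.
elim/big_ind: _ => [||j _].
- by rewrite /spans big1// => u _; rewrite dotC dot0r scale0r.
- exact: spansD.
have [bj|bj] := eqVneq (b j 0) 0.
  rewrite bj scale0r /spans big1// => u _; rewrite dotC dot0r scale0r//.
by apply: spansZ; apply: sX; apply: bF; rewrite inE.
Qed.

Lemma norm2_ge0 {R : realType} {n : nat} (x : 'cV[R]_n) : 0 <= norm2 x.
Proof. exact: sqrtr_ge0. Qed.

Lemma sqr_norm2 {R : realType} {n : nat} (x : 'cV[R]_n) : norm2 x ^+ 2 = dot x x.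
Proof.
rewrite sqr_sqrtr; last by apply: sumr_ge0 => i _; exact: sqr_ge0.
by apply: eq_bigr => i _; rewrite expr2.
Qed.

(** The expansion of [x] sees only the coordinates of [z] along [us], so Cauchy-Schwarz holds with
    the norm of the projection of [z]. This ties the noise to the size of the basis instead of
    [n]. *)
Lemma dot_le_spans {R : realType} {n : nat} (us : seq 'cV[R]_n) (x z : 'cV[R]_n) :
  orthonormal_seq us -> spans us x ->
  dot x z <= norm2 x * Num.sqrt (\sum_(u <- us) dot u z ^+ 2).
Proof.
move=> ous sx.
set q := \sum_(u <- us) _.
have q0 : 0 <= q by apply: sumr_ge0 => u _; exact: sqr_ge0.
have mE : dot x z = \sum_(u <- us) dot x u * dot u z.
  by rewrite {1}sx dotC dot_sumr; apply: eq_bigr => u _; rewrite dotZr (dotC z).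
have sE : dot x x = \sum_(u <- us) dot x u ^+ 2.
  by rewrite {2}sx dot_sumr; apply: eq_bigr => u _; rewrite dotZr.
have quad t : 0 <= t ^+ 2 * dot x x - 2 * t * dot x z + q.
  rewrite mE sE !mulr_sumr -sumrB -big_split; apply: sumr_ge0 => u _ /=.
  rewrite (_ : _ + _ = (t * dot x u - dot u z) ^+ 2) ?sqr_ge0//; ring.
have [x0|x0] := eqVneq (dot x x) 0.
  have /eqP -> : x == 0 by rewrite -dot_eq0 x0.
  by rewrite dotC dot0r mulr_ge0 ?norm2_ge0// sqrtr_ge0.
have dx : 0 < dot x x by rewrite lt0r x0 dot_ge0.
have cs : dot x z ^+ 2 <= dot x x * q.
  (* This [t] minimises the quadratic; its value there, times [dot x x], is
     [dot x x * q - dot x z ^+ 2]. *)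
  have := quad (dot x z / dot x x).
  rewrite -(pmulr_rge0 _ dx) => h; rewrite -subr_ge0.
  rewrite (_ : _ - _ = dot x x * ((dot x z / dot x x) ^+ 2 * dot x x -
    2 * (dot x z / dot x x) * dot x z + q))//; by field.
rewrite (le_trans (ler_norm _))// -sqrtr_sqr /norm2.
rewrite -(sqr_sqrtr (_ : 0 <= dot x x)) ?dot_ge0// in cs.
rewrite -sqrtrM; last by apply: sumr_ge0 => i _; exact: sqr_ge0.
rewrite ler_wsqrtr//; move: cs; rewrite sqr_sqrtr ?dot_ge0//.
Qed.

(** With a basis spanning both vectors, Parseval turns the projected norm of [z] into [norm2 z]. *)
Lemma dot_le_norm2 {R : realType} {n : nat} (x z : 'cV[R]_n) :
  dot x z <= norm2 x * norm2 z.
Proof.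
have [us [ous _ sx]] := gram_schmidt [:: x; z].
have sz : spans us z by apply: sx; rewrite !inE eqxx orbT.
rewrite (le_trans (@dot_le_spans _ _ us x z ous _))//.
  by apply: sx; rewrite inE eqxx.
rewrite ler_wpM2l ?norm2_ge0// -(ger0_norm (norm2_ge0 z)) -sqrtr_sqr.
apply: ler_wsqrtr; rewrite sqr_norm2 {3}sz dot_sumr; apply: ler_sum => u _.
by rewrite dotZr (dotC u).
Qed.

(** * Quadratic forms and tail bounds *)

(** Completing the square makes the integrand a multiple of the normal density centred at [c]. *)
Lemma gaussian_mgf (R : realType) (c : R) :
  (\int[lebesgue_measure]_g (expR (c * g) * normal_pdf 0 1 g)%:E
   = (expR (c ^+ 2 / 2))%:E)%E.
Proof.
have n1 : (1 : R) != 0 by exact: oner_neq0.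
transitivity (\int[lebesgue_measure]_g
   ((expR (c ^+ 2 / 2))%:E * (normal_pdf c 1 g)%:E))%E.
  apply: eq_integral => g _; rewrite -EFinM !normal_pdfE// /normal_fun.
  congr (_%:E); rewrite mulrCA [RHS]mulrCA; congr (_ * _); rewrite -!expRD.
  by congr expR; lra.
rewrite ge0_integralZl//.
- by rewrite integral_normal_pdf mule1.
- by apply/measurable_EFinP; exact: measurable_normal_pdf.
- by move=> x _; rewrite lee_fin normal_pdf_ge0.
Qed.

(** The exponent [g ^+ 2 / 4 - g ^+ 2 / 2 = - g ^+ 2 / 4] is that of a centred normal law of
    variance 2, whose peak is smaller by a factor [sqrt 2]. *)
Lemma gaussian_sqr_mgf (R : realType) :
  (\int[lebesgue_measure]_g (expR (g ^+ 2 / 4) * normal_pdf 0 1 g)%:E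
   = (Num.sqrt 2 : R)%:E)%E.
Proof.
have n1 : (1 : R) != 0 by exact: oner_neq0.
have s20 : (Num.sqrt 2 : R) != 0 by rewrite gt_eqF// sqrtr_gt0.
transitivity (\int[lebesgue_measure]_g
   ((Num.sqrt 2 : R)%:E * (normal_pdf 0 (Num.sqrt 2) g)%:E))%E.
  apply: eq_integral => g _; rewrite -EFinM !normal_pdfE// /normal_fun /normal_peak.
  congr (_%:E); rewrite mulrCA [RHS]mulrA; congr (_ * _).
    rewrite expr1n mul1r sqr_sqrtr// -mulrnAr sqrtrM// invfM mulrA.
    by rewrite divff// mul1r.
  rewrite -!expRD; congr expR; rewrite sqr_sqrtr// expr1n; lra.
rewrite ge0_integralZl//.
- by rewrite integral_normal_pdf mule1.
- by apply/measurable_EFinP; exact: measurable_normal_pdf.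
- by move=> x _; rewrite lee_fin normal_pdf_ge0.
Qed.

Lemma measurable_dot (R : realType) (d : measure_display) (T : measurableType d)
  (n : nat) (u : 'cV[R]_n) (Z : T -> 'cV[R]_n) :
  (forall i, measurable_fun setT (fun w => Z w i 0)) ->
  measurable_fun setT (fun w => dot u (Z w)).
Proof.
by move=> mZ; apply: measurable_sum => i; apply: measurable_funM.
Qed.

(* Averaging over a standard normal [g] turns [exp (dot u Z ^+ 2 / 4)] into the
   mean of [exp (g * dot u Z / sqrt 2)], which the linear bound controls. *)
Lemma subgaussian_quadratic_mgf (R : realType) (d : measure_display)
  (T : measurableType d) (P : probability T R) (n : nat) (Z : T -> 'cV[R]_n)
  (us : seq 'cV[R]_n) (l : 'cV[R]_n) :
  (forall i, measurable_fun setT (fun w => Z w i 0)) ->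
  (forall v, (\int[P]_w (expR (dot v (Z w)))%:E <= (expR (dot v v / 2))%:E)%E) ->
  orthonormal_seq us -> all (fun u => dot u l == 0) us ->
  (\int[P]_w (expR (dot l (Z w) + (\sum_(u <- us) dot u (Z w) ^+ 2) / 4))%:E
   <= (expR (dot l l / 2) * Num.sqrt 2 ^+ size us)%:E)%E.
Proof.
(* [l] is generalised because each step tilts the linear term by a multiple of the removed vector
   [u]. *)
move=> mZ mgf; elim: us l => [|u us IH] l.
  move=> _ _; rewrite expr0 mulr1.
  by under eq_integral do rewrite big_nil mul0r addr0.
rewrite /orthonormal_seq/= => /andP[/andP[uus pus] /andP[/eqP uu nus]] /andP[/eqP ul usl].
pose r w := (\sum_(v <- us) dot v (Z w) ^+ 2) / 4.
(* With [c ^+ 2 = 1 / 2] the Gaussian mean of [exp (c * x * g)] is [exp (x ^+ 2 / 4)]. *)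
pose c : R := (Num.sqrt 2)^-1.
have c2 : c ^+ 2 = 2^-1 by rewrite /c exprVn sqr_sqrtr.
pose F (wg : T * R) := expR (dot l (Z wg.1) + r wg.1 + c * dot u (Z wg.1) * wg.2)
  * normal_pdf 0 1 wg.2.
have mdot v : measurable_fun setT (fun w => dot v (Z w)) by exact: measurable_dot.
have mr : measurable_fun setT r.
  apply: measurable_funM => //; apply: measurable_sum => v.
  exact: measurable_funX.
have mF : measurable_fun setT F.
  apply: measurable_funM.
    apply: measurableT_comp => //; apply: measurable_funD.
      apply: (@measurableT_comp _ _ _ _ _ _ (fun w => dot l (Z w) + r w)) => //.
      exact: measurable_funD.
    apply: measurable_funM => //; apply: measurable_funM => //.
    exact: (@measurableT_comp _ _ _ _ _ _ (fun w => dot u (Z w))).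
  apply: measurableT_comp => //; exact: measurable_normal_pdf.
have F0 x : (0 <= (F x)%:E)%E by rewrite lee_fin mulr_ge0 ?expR_ge0 ?normal_pdf_ge0.
have eqF w : (expR (dot l (Z w) + (\sum_(v <- u :: us) dot v (Z w) ^+ 2) / 4))%:E =
    (\int[lebesgue_measure]_g (F (w, g))%:E)%E.
  transitivity (\int[lebesgue_measure]_g ((expR (dot l (Z w) + r w))%:E *
     (expR (c * dot u (Z w) * g) * normal_pdf 0 1 g)%:E))%E; last first.
    by apply: eq_integral => g _; rewrite -EFinM /F/= [in RHS]expRD mulrA.
  rewrite ge0_integralZl//.
  - rewrite gaussian_mgf -EFinM -expRD exprMn c2 big_cons /r; congr (expR _)%:E.
    lra.
  - apply/measurable_EFinP; apply: measurable_funM; last exact: measurable_normal_pdf.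
    apply: measurableT_comp => //; apply: measurable_funM => //.
  - by move=> g _; rewrite lee_fin mulr_ge0 ?expR_ge0 ?normal_pdf_ge0.
under eq_integral do rewrite eqF.
rewrite (@fubini_tonelli _ _ T _ R P lebesgue_measure (EFin \o F))//; last first.
  exact/measurable_EFinP.
pose K := expR (dot l l / 2) * Num.sqrt 2 ^+ size us.
have K0 : 0 <= K by rewrite mulr_ge0 ?expR_ge0// exprn_ge0// sqrtr_ge0.
apply: (@le_trans _ _ (\int[lebesgue_measure]_g
   (K%:E * (expR (g ^+ 2 / 4) * normal_pdf 0 1 g)%:E))%E).
  apply: ge0_le_integral => //.
  - by move=> g _; apply: integral_ge0 => w _; exact: F0.
  - by apply: (@measurable_fun_fubini_tonelli_G _ _ T _ R P (EFin \o F)) => //; exact/measurable_EFinP.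
  - apply/measurable_EFinP; apply: measurable_funM => //.
    apply: measurable_funM; last exact: measurable_normal_pdf.
    by apply: measurableT_comp => //; apply: measurable_funM.
  - move=> g _.
    have mexp v : measurable_fun setT (fun w => expR (dot v (Z w) + r w)).
      by apply: measurableT_comp => //; exact: measurable_funD.
    have -> : (\int[P]_w (EFin \o F) (w, g) = (normal_pdf 0 1 g)%:E *
       \int[P]_w (expR (dot (l + (c * g) *: u) (Z w) + r w))%:E)%E.
      rewrite -ge0_integralZl//.
      + apply: eq_integral => w _; rewrite -EFinM /F/= mulrC dotDl dotZl.
        by congr (_ * expR _)%:E; ring.
      + exact/measurable_EFinP.
      + by rewrite lee_fin normal_pdf_ge0.
    (* As [u] is a unit vector orthogonal to [l], the tilted direction has squared norm
       [dot l l + g ^+ 2 / 2]; half of the second term is the exponent [g ^+ 2 / 4]. *)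
    have -> : (K%:E * (expR (g ^+ 2 / 4) * normal_pdf 0 1 g)%:E =
       (normal_pdf 0 1 g)%:E * (expR (dot (l + (c * g) *: u) (l + (c * g) *: u) / 2)
          * Num.sqrt 2 ^+ size us)%:E)%E.
      rewrite -!EFinM; congr (_%:E).
      rewrite dotDl !dotDr !dotZl !dotZr uu (dotC l u) ul !mulr0 addr0 add0r mulr1.
      rewrite -expr2 exprMn c2 /K mulrDl expRD.
      rewrite (_ : 2^-1 * g ^+ 2 / 2 = g ^+ 2 / 4); last by lra.
      ring.
    apply: lee_wpmul2l; first by rewrite lee_fin normal_pdf_ge0.
    apply: IH; first by rewrite /orthonormal_seq pus.
    apply/allP => v vus; rewrite dotDr dotZr (eqP (allP usl v vus)).
    by rewrite dotC (eqP (allP uus v vus)) mulr0 addr0.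
rewrite ge0_integralZl//.
- by rewrite gaussian_sqr_mgf -EFinM lee_fin /K/= exprS; lra.
- apply/measurable_EFinP; apply: measurable_funM; last exact: measurable_normal_pdf.
  by apply: measurableT_comp => //; apply: measurable_funM.
- by move=> g _; rewrite lee_fin mulr_ge0 ?expR_ge0 ?normal_pdf_ge0.
Qed.

Lemma measurable_superlevel {R : realType} {d : measure_display}
  {T : measurableType d} (f : T -> R) (a : R) :
  measurable_fun setT f -> measurable [set w | a < f w].
Proof.
move=> mf; rewrite -[X in measurable X]setTI.
have -> : [set w | a < f w] = f @^-1` `]a, +oo[%classic.
  by apply/seteqP; split => w /=; rewrite in_itv/= andbT.
exact: mf.
Qed.

Lemma ln2_le1 (R : realType) : ln 2 <= 1 :> R.
Proof. by rewrite -[2]/(1 + 1) le_ln1Dx. Qed.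

(** Markov's inequality for [expR (f w)] at level [expR a]. *)
Lemma chernoff (R : realType) (d : measure_display) (T : measurableType d)
  (P : probability T R) (f : T -> R) (a K : R) :
  measurable_fun setT f -> (\int[P]_w (expR (f w))%:E <= K%:E)%E ->
  (P [set w | (a < f w)%R] <= (expR (- a) * K)%:E)%E.
Proof.
move=> mf intf.
have mexp : measurable_fun setT (fun w => expR (f w)) by exact: measurableT_comp.
have mS := measurable_superlevel f a mf.
have h : ((expR a)%:E * P [set w | (a < f w)%R] <= K%:E)%E.
  have mE : measurable_fun setT (EFin \o (fun w => expR (f w))) by exact/measurable_EFinP.
  have := @le_integral_abse _ _ _ P _ measurableT _ (expR a) mE (expR_gt0 _).
  under eq_integral do rewrite /= ger0_norm ?expR_ge0//.
  move=> h; apply: le_trans (le_trans h intf).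
  apply: lee_wpmul2l; first by rewrite lee_fin expR_ge0.
  apply: le_measure; rewrite ?inE//.
  - rewrite setTI -[X in measurable X]setTI.
    by apply: emeasurable_fun_c_infty => //; exact: measurableT_comp.
  - move=> w /= aw; split => //; rewrite lee_fin ger0_norm ?expR_ge0//.
    by rewrite ler_expR ltW.
by rewrite EFinM expRN -lee_pdivlMl ?expR_gt0// in h *.
Qed.

(** Rescaling [v] to [u] with [dot u u = 2 * L] moves the threshold to [2 * L], and Chernoff gives
    [exp (- 2 * L) * exp L]. If [v = 0] the strict inequality is impossible; if [L = 0] the bound is
    1. *)
Lemma subgaussian_linear_tail (R : realType) (d : measure_display)
  (T : measurableType d) (P : probability T R) (n : nat) (Z : T -> 'cV[R]_n)
  (v : 'cV[R]_n) (L : R) :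
  (forall i, measurable_fun setT (fun w => Z w i 0)) ->
  (forall v, (\int[P]_w (expR (dot v (Z w)))%:E <= (expR (dot v v / 2))%:E)%E) ->
  0 <= L ->
  (P [set w | (norm2 v * Num.sqrt (2 * L) < dot v (Z w))%R] <= (expR (- L))%:E)%E.
Proof.
move=> mZ mgf L0.
have [->|v0] := eqVneq v 0.
  rewrite (_ : [set _ | _] = set0) ?measure0 ?lee_fin ?expR_ge0//.
  apply/seteqP; split => w //=; rewrite dotC dot0r ltNge.
  by rewrite mulr_ge0 ?norm2_ge0 ?sqrtr_ge0.
have nv : 0 < norm2 v by rewrite lt0r norm2_ge0 -sqrf_eq0 sqr_norm2 dot_eq0 v0.
pose r := Num.sqrt (2 * L).
have r2 : r ^+ 2 = 2 * L by rewrite sqr_sqrtr// mulr_ge0.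
have r0 : 0 <= r by exact: sqrtr_ge0.
pose u := (r / norm2 v) *: v.
have uu : dot u u = 2 * L.
  by rewrite dotZl dotZr -sqr_norm2 -r2; field; rewrite gt_eqF.
have mdot x : measurable_fun setT (fun w => dot x (Z w)) by exact: measurable_dot.
have [rz|rp] := eqVneq r 0.
  have -> : L = 0 by move: r2; rewrite rz expr0n/=; lra.
  by rewrite oppr0 expR0; apply: probability_le1; exact: measurable_superlevel.
have -> : [set w | norm2 v * Num.sqrt (2 * L) < dot v (Z w)] =
          [set w | 2 * L < dot u (Z w)].
  apply/seteqP; split => w /=; rewrite -/r dotZl -r2 mulrAC ltr_pdivlMr//;
    by rewrite expr2 -mulrA ltr_pM2l ?lt0r ?rp// mulrC.
rewrite (le_trans (@chernoff _ _ _ P _ _ (expR L) (mdot u) _))//.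
  by rewrite (le_trans (mgf u))// uu mulrAC divff// mul1r.
by rewrite -expRD lee_fin ler_expR; lra.
Qed.

(** Chernoff for a quarter of the quadratic form, with no linear term: each basis vector costs a
    factor [sqrt 2 = exp (ln 2 / 2)], which is at least 1, so [k] may replace the size. *)
Lemma subgaussian_quadratic_tail (R : realType) (d : measure_display)
  (T : measurableType d) (P : probability T R) (n k : nat) (Z : T -> 'cV[R]_n)
  (us : seq 'cV[R]_n) (a : R) :
  (forall i, measurable_fun setT (fun w => Z w i 0)) ->
  (forall v, (\int[P]_w (expR (dot v (Z w)))%:E <= (expR (dot v v / 2))%:E)%E) ->
  orthonormal_seq us -> (size us <= k)%N ->
  (P [set w | (a < \sum_(u <- us) dot u (Z w) ^+ 2)%R]
    <= (expR (- (a / 4) + k%:R * ln 2 / 2))%:E)%E.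
Proof.
move=> mZ mgf ous sus.
have -> : [set w | a < \sum_(u <- us) dot u (Z w) ^+ 2] =
  [set w | a / 4 < (\sum_(u <- us) dot u (Z w) ^+ 2) / 4].
  by apply/seteqP; split => w /=; rewrite ltr_pM2r.
rewrite (le_trans (@chernoff _ _ _ P _ _ (Num.sqrt 2 ^+ size us) _ _))//.
- apply: measurable_funM => //; apply: measurable_sum => u.
  by apply: measurable_funX; exact: measurable_dot.
- have := @subgaussian_quadratic_mgf _ _ _ P _ Z us 0 mZ mgf ous.
  rewrite dot0r mul0r expR0 mul1r; under eq_integral do rewrite dotC dot0r add0r.
  by apply; apply/allP => u _; rewrite dot0r.
rewrite lee_fin expRD ler_pM2l ?expR_gt0//.
have s2E : expR (ln 2 / 2) = Num.sqrt 2 :> R.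
  rewrite -[LHS]ger0_norm ?expR_ge0// -sqrtr_sqr -expRM_natl.
  by rewrite mulrC divfK// lnK// posrE.
rewrite -mulrA expRM_natl s2E; apply: ler_weXn2l => //.
by rewrite -{1}sqrtr1 ler_wsqrtr// ler1n.
Qed.

Lemma finite_union_bound (R : realType) (d : measure_display)
  (T : measurableType d) (P : probability T R) (I : eqType) (r : seq I)
  (A : I -> set T) (b : I -> R) :
  (forall i, measurable (A i)) -> (forall i, (P (A i) <= (b i)%:E)%E) ->
  exists E, [/\ measurable E, ((1 - \sum_(i <- r) b i)%:E <= P E)%E &
    forall w i, E w -> i \in r -> ~ A i w].
Proof.
move=> mA PA; pose U s := \big[setU/set0]_(i <- s) A i.
have mU s : measurable (U s) by exact: bigsetU_measurable.
exists (~` U r); split.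
- exact: measurableC.
- have PU : (P (U r) <= (\sum_(i <- r) b i)%:E)%E.
    rewrite /U; elim: r => [|i s IH]; first by rewrite !big_nil measure0.
    rewrite !big_cons EFinD; apply: le_trans (leeD (PA i) IH).
    by apply: measureU2 => //; exact: mU.
  by rewrite probability_setC// EFinB leeB.
- move=> w i nU; rewrite -/U in nU => ir Aw; apply: nU.
  by rewrite /U (big_rem i ir)/=; left.
Qed.

(** The function [e^f + e^(-f) - 2] is nonnegative with integral at most 0, and it vanishes only
    where [f] does. This serves the degenerate case [sigma = 0]. *)
Lemma subgaussian0_ae0 (R : realType) (d : measure_display)
  (T : measurableType d) (P : probability T R) (f : T -> R) :
  measurable_fun setT f ->
  (\int[P]_w (expR (f w))%:E <= 1)%E -> (\int[P]_w (expR (- f w))%:E <= 1)%E ->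
  P [set w | f w != 0] = 0%E.
Proof.
move=> mf if1 if2.
pose h w := expR (f w) + expR (- f w) - 2.
have mfp : measurable_fun setT (fun w => expR (f w)) by exact: measurableT_comp.
have mfn : measurable_fun setT (fun w => expR (- f w)).
  by apply: measurableT_comp => //; exact: measurableT_comp.
have mh : measurable_fun setT h.
  by apply: measurable_funB => //; exact: measurable_funD.
(* [e^x + e^(-x) - 2 = (e^(x/2) - e^(-x/2)) ^+ 2] *)
have hE w : h w = (expR (f w / 2) - expR (- (f w / 2))) ^+ 2.
  have e1 : expR (f w) = expR (f w / 2) ^+ 2.
    by rewrite -expRM_natl mulrC divfK.
  have e2 : expR (- f w) = expR (- (f w / 2)) ^+ 2.
    by rewrite -expRM_natl mulrN mulrC divfK.
  have : expR (f w / 2) * expR (- (f w / 2)) = 1 by rewrite -expRD subrr expR0.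
  rewrite /h e1 e2; set x := expR (f w / 2); set y := expR _ => xy.
  by rewrite sqrrB xy; ring.
have h0 w : 0 <= h w by rewrite hE sqr_ge0.
have ih : (\int[P]_w `|(h w)%:E| = 0)%E.
  apply/eqP; rewrite eq_le integral_ge0// andbT.
  under eq_integral do rewrite /= ger0_norm//.
  (* Adding 2 leaves a sum of two exponentials, so additivity for nonnegative functions applies; the
     finite constant is cancelled afterwards. *)
  have : (\int[P]_w ((h w)%:E + 2%:E) <= 1 + 1)%E.
    apply: le_trans (leeD if1 if2); rewrite -ge0_integralD//; last 2 first.
    - exact/measurable_EFinP.
    - exact/measurable_EFinP.
    rewrite le_eqVlt; apply/orP; left; apply/eqP; apply: eq_integral => w _.
    by rewrite -!EFinD /h subrK.
  rewrite ge0_integralD//; first last.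
  - exact/measurable_EFinP.
  - by move=> w _; rewrite lee_fin.
  have -> : (\int[P]__ 2%:E = 2%:E)%E.
    by rewrite -[RHS](expectation_cst P 2) unlock.
  rewrite -EFinD.
  rewrite [X in (_ <= X)%E](_ : _ = 0 + 2%:E)%E; last by rewrite add0e.
  by rewrite leeD2rE.
have mEh : measurable_fun setT (EFin \o h) by exact/measurable_EFinP.
have [N [mN N0 fN]] := (ae_eq_integral_abs P measurableT mEh).1 ih.
have f0N : [set w | f w != 0] `<=` N.
  move=> w /= fw0; apply: fN => /= /(_ I) [] /eqP.
  rewrite hE sqrf_eq0 subr_eq0 => /eqP/expR_inj; move/eqP: fw0; lra.
apply: (subset_measure0 _ mN f0N N0).
have -> : [set w | f w != 0] = ~` (f @^-1` [set 0]).
  by apply/seteqP; split => w /= /eqP.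
by apply: measurableC; rewrite -[X in measurable X]setTI; exact: mf.
Qed.

(** The Kraft sum leaves out the empty set, whose code length 0 contributes one more unit. *)
Lemma coding_length_sum (R : realType) (p : nat) (cl : {set 'I_p} -> \bar R) :
  coding_length cl -> \sum_(F : {set 'I_p}) pow2neg (cl F) <= 2.
Proof.
move=> [cl0 _ kraft]; rewrite (bigD1 (finset.set0 : {set 'I_p}))//= cl0.
by rewrite [pow2neg _]/= oppr0 mul0r expR0; lra.
Qed.

(** One [exp (- L)] pays for the linear term. Each [F] receives the share
    [2 * pow2neg (cl F) * exp (- L)], and these shares add up to at most [4 * exp (- L)]. *)
Lemma subgaussian_good_event (R : realType) (d : measure_display)
  (T : measurableType d) (P : probability T R) (n p : nat) (xi : T -> 'cV[R]_n)
  (sigma : R) (cl : {set 'I_p} -> \bar R) (us : {set 'I_p} -> seq 'cV[R]_n)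
  (v : 'cV[R]_n) (L : R) :
  (forall i, measurable_fun setT (fun w => xi w i 0)) ->
  (forall l, (\int[P]_w (expR (dot l (xi w)))%:E
     <= (expR (sigma ^+ 2 * dot l l / 2))%:E)%E) ->
  0 <= sigma -> coding_length cl ->
  (forall F, orthonormal_seq (us F)) -> (forall F, (size (us F) <= #|F| + 2)%N) ->
  0 <= L ->
  exists E, [/\ measurable E, ((1 - 5 * expR (- L))%:E <= P E)%E &
    forall w, E w ->
      dot v (xi w) <= norm2 v * (sigma * Num.sqrt (2 * L)) /\
      forall F, (cl F < +oo)%E -> \sum_(u <- us F) dot u (xi w) ^+ 2 <=
        sigma ^+ 2 * (5 * fine (cc_set cl F) + 4 * L)].
Proof.
move=> mxi mgf s0 hcl ous sus L0.
(* For [sigma = 0] the noise cannot be normalised; instead [xi] vanishes almost surely, coordinate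
   by coordinate, and both bounds become [0 <= 0]. *)
have [sE|sp] := eqVneq sigma 0.
  have mgf0 l : (\int[P]_w (expR (dot l (xi w)))%:E <= 1)%E.
    by rewrite (le_trans (mgf l))// sE expr0n/= !mul0r expR0.
  have dotd (i : 'I_n) x : dot (delta_mx i 0) x = x i 0 :> R.
    rewrite /dot (bigD1 i)//= mxE !eqxx mul1r big1 ?addr0// => j /negbTE ji.
    by rewrite mxE ji mul0r.
  have P0 (i : 'I_n) : (P [set w | xi w i ord0 != 0%R] <= 0%:E)%E.
    rewrite subgaussian0_ae0//.
      by have := mgf0 (delta_mx i 0); under eq_integral do rewrite dotd.
    have := mgf0 (- delta_mx i 0).
    by under eq_integral do rewrite dotNl dotd.
  have mA (i : 'I_n) : measurable [set w | xi w i ord0 != 0%R].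
    have -> : [set w | xi w i ord0 != 0] = ~` ((fun w => xi w i ord0) @^-1` [set 0]).
      by apply/seteqP; split => w /= /eqP.
    by apply: measurableC; rewrite -[X in measurable X]setTI; exact: mxi.
  have [E [mE PE HE]] := @finite_union_bound _ _ _ P _ (enum 'I_n) _ (fun=> 0) mA P0.
  exists E; split => //.
    apply: le_trans PE; rewrite lee_fin big1// lerD2l lerN2.
    by rewrite mulr_ge0// expR_ge0.
  move=> w Ew; have -> : xi w = 0.
    apply/matrixP => i j; rewrite (ord1 j) mxE; apply/eqP; apply: contrapT.
    by move=> /negP; apply: (HE w i Ew); rewrite mem_enum.
  rewrite dot0r sE mul0r mulr0; split => // F _.
  by rewrite expr0n/= mul0r big1// => u _; rewrite dot0r expr0n.
have {}sp : 0 < sigma by rewrite lt0r sp.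
pose Z w := sigma^-1 *: xi w.
have mZ i : measurable_fun setT (fun w => Z w i 0).
  rewrite (_ : (fun _ => _) = (fun w => sigma^-1 * xi w i 0)).
    exact: measurable_funM.
  by apply/funext => w; rewrite mxE.
have mgfZ l : (\int[P]_w (expR (dot l (Z w)))%:E <= (expR (dot l l / 2))%:E)%E.
  have := mgf (sigma^-1 *: l).
  under eq_integral do rewrite dotZl -dotZr.
  move=> /le_trans; apply; rewrite lee_fin ler_expR dotZl dotZr.
  by rewrite le_eqVlt; apply/orP; left; apply/eqP; field; rewrite gt_eqF.
have xiE w x : dot x (xi w) = sigma * dot x (Z w).
  by rewrite dotZr mulrA divff ?mul1r// gt_eqF.
pose a F := 5 * fine (cc_set cl F) + 4 * L.
(* [None] indexes the deviation of the linear term, [Some F] that of [A_F ^+ 2]. *)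
pose A (o : option {set 'I_p}) := if o is Some F then
   if cl F == +oo%E then set0 else [set w | a F < \sum_(u <- us F) dot u (Z w) ^+ 2]
  else [set w | norm2 v * Num.sqrt (2 * L) < dot v (Z w)].
pose b (o : option {set 'I_p}) := if o is Some F then
   2 * pow2neg (cl F) * expR (- L) else expR (- L).
have mA o : measurable (A o).
  case: o => [F|] /=.
    case: ifP => // _; apply: measurable_superlevel; apply: measurable_sum => u.
    by apply: measurable_funX; exact: measurable_dot.
  by apply: measurable_superlevel; exact: measurable_dot.
have PA o : (P (A o) <= (b o)%:E)%E.
  case: o => [F|] /=; last exact: subgaussian_linear_tail.
  have [_|clF] := eqVneq (cl F) +oo%E.
    by rewrite measure0 lee_fin !mulr_ge0 ?expR_ge0//; case: (cl F) => *; rewrite //= expR_ge0.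
  rewrite (le_trans (@subgaussian_quadratic_tail _ _ _ P _ (#|F| + 2) Z (us F) (a F) mZ mgfZ _ _))//.
  have [_ /(_ F) + _] := hcl; rewrite /a /cc_set.
  move: clF; case: (cl F) => [r| |]//= _; rewrite lee_fin => r0.
  (* [exp (- (5 c(F) + 4 L) / 4) * 2^((|F| + 2) / 2) <= 2 * 2^(- cl F) * exp (- L)],
     because [ln 2 <= 1]. *)
  have e2 : 2 = expR (ln 2) :> R by rewrite lnK// posrE.
  rewrite lee_fin /pow2neg [X in _ <= X * _ * _]e2 -!expRD ler_expR natrD.
  have l1 := ln2_le1 R; have F0 : 0 <= #|F|%:R :> R by [].
  have l0 : 0 <= ln 2 :> R by rewrite ln_ge0// ler1n.
  have Fl : #|F|%:R * ln 2 <= #|F|%:R :> R by rewrite ler_piMr.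
  have rl : r * ln 2 <= r by rewrite ler_piMr.
  move: Fl rl => /=; set x := #|F|%:R; set l := ln 2; lra.
have [E [mE PE HE]] := @finite_union_bound _ _ _ P _
  (None :: map Some (index_enum {set 'I_p})) _ b mA PA.
exists E; split => //.
  apply: le_trans PE; rewrite lee_fin lerD2l lerN2 big_cons big_map/=.
  rewrite -mulr_suml -mulr_sumr.
  have := @coding_length_sum _ _ _ hcl; have := expR_ge0 (- L).
  set e := expR _; set S := \sum_F _; nra.
move=> w Ew; split.
  have /= /negP := HE w None Ew (mem_head _ _); rewrite -leNgt => h.
  by rewrite xiE mulrCA ler_pM2l.
move=> F clF.
have : ~ A (Some F) w by apply: HE => //; rewrite inE mem_map ?mem_index_enum// => ? ? [].
rewrite /A lt_eqF//= => /negP; rewrite -leNgt => h.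
under eq_bigr do rewrite xiE exprMn.
by rewrite -mulr_sumr ler_pM2l ?exprn_gt0.
Qed.

(** * From the good event to the oracle inequalities *)

(** The full index set is always admissible, so the minimum runs over a nonempty finite family and
    is attained, even when its value is [+oo]. *)
Lemma cc_attained (R : realType) (p : nat) (cl : {set 'I_p} -> \bar R)
  (b : 'cV[R]_p) :
  exists2 F : {set 'I_p}, supp b \subset F & cc cl b = cc_set cl F.
Proof.
have sT : supp b \subset [set: 'I_p]%SET by exact: finset.subsetT.
have [F bF ccE] := @eq_bigmin _ _ _ +oo%E _ (fun F : {set 'I_p} => supp b \subset F)
  (cc_set cl) sT (fun F _ => leey _).
by exists F; last exact: ccE.
Qed.

Lemma norm2N (R : realType) (n : nat) (x : 'cV[R]_n) : norm2 (- x) = norm2 x.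
Proof. by congr Num.sqrt; apply: eq_bigr => i _; rewrite mxE sqrrN. Qed.

Lemma rho_minus_mul_le (R : realType) (n p : nat) (X : 'M[R]_(n, p))
  (cl : {set 'I_p} -> \bar R) (s : \bar R) (F : {set 'I_p}) (x : 'cV[R]_p) :
  (cc_set cl F <= s)%E -> supp x \subset F ->
  ((n%:R)%:E * rho_minus X cl s * (norm2 x ^+ 2)%:E <= (norm2 (X *m x) ^+ 2)%:E)%E.
Proof.
move=> Fs xF.
(* The cases [n = 0] and [x = 0] come first: the left side is then 0, also if the infimum is [+oo],
   and the remaining divisions are genuine. *)
have [->|n0] := eqVneq (n%:R : R) 0; first by rewrite !mul0e lee_fin sqr_ge0.
have [x0|x0] := eqVneq x 0.
  have -> : norm2 x ^+ 2 = 0 by rewrite sqr_norm2 x0 dot0r.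
  by rewrite mule0 lee_fin sqr_ge0.
have nx : norm2 x ^+ 2 != 0 by rewrite sqr_norm2 dot_eq0.
have rho_le : (rho_minus X cl s <=
    ((n%:R)^-1 * norm2 (X *m x) ^+ 2 / norm2 x ^+ 2)%:E)%E.
  apply: (@le_trans _ _ (rho_minus_set X F)).
    by apply: ereal_inf_lbound; exists F.
  by apply: ereal_inf_lbound; exists x.
apply: (@le_trans _ _ ((n%:R)%:E * ((n%:R)^-1 * norm2 (X *m x) ^+ 2 / norm2 x ^+ 2)%:E
   * (norm2 x ^+ 2)%:E)%E).
  apply: lee_wpmul2r; first by rewrite lee_fin sqr_ge0.
  by apply: lee_wpmul2l => //; rewrite lee_fin.
by rewrite -!EFinM lee_fin -mulrA divfK// mulrA divff// mul1r.
Qed.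

(** Completing the square, [(U - A) ^+ 2 <= V ^+ 2 + 2 * V * s + C ^+ 2 <= (V + s + C) ^+ 2] with
    [C ^+ 2 = A ^+ 2 + e]; then [A] and [C] are both at most [sqrt B]. *)
Lemma quadratic_bound (R : realType) (U V s A e B : R) :
  0 <= U -> 0 <= V -> 0 <= s -> 0 <= A -> 0 <= e -> A ^+ 2 + e <= B ->
  U ^+ 2 <= V ^+ 2 + 2 * (V * s) + 2 * (U * A) + e ->
  U <= V + s + 2 * Num.sqrt B.
Proof.
move=> U0 V0 s0 A0 e0 AB h.
pose C := Num.sqrt (A ^+ 2 + e).
have C2 : C ^+ 2 = A ^+ 2 + e by rewrite sqr_sqrtr// addr_ge0// sqr_ge0.
have C0 : 0 <= C by exact: sqrtr_ge0.
have AC : A <= C.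
  by rewrite -[A]ger0_norm// -sqrtr_sqr ler_wsqrtr// lerDl.
have CB : C <= Num.sqrt B by exact: ler_wsqrtr.
suff : U <= V + s + A + C by lra.
rewrite leNgt; apply/negP => lt.
have : (V + s + C) ^+ 2 < (U - A) ^+ 2.
  by rewrite ltr_pXn2r ?nnegrE//; lra.
nra.
Qed.

Lemma distance_bound (R : realType) (D V A e : R) :
  D ^+ 2 <= 2 * (D * V) + 2 * (D * A) + e ->
  D ^+ 2 <= 10 * V ^+ 2 + 50 / 7 * A ^+ 2 + 5 / 2 * e.
Proof.
(* AM-GM: [2 D (V + A) <= 3/5 D^2 + 5/3 (V + A)^2] and
   [(V + A)^2 <= 12/5 V^2 + 12/7 A^2]. *)
move=> h.
have h1 : 0 <= (3 * D - 5 * (V + A)) ^+ 2 by exact: sqr_ge0.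
have h2 : 0 <= (7 * V - 5 * A) ^+ 2 by exact: sqr_ge0.
nra.
Qed.

(** [fine] would send an infinite complexity to 0, hence the restriction to finite [cc cl b]; for
    [sigma > 0] and infinite complexity the intended right-hand sides are infinite. *)
Theorem theorem2 (R : realType) (d : measure_display) (T : measurableType d)
  (P : probability T R) (n p : nat) (X : 'M[R]_(n, p))
  (y : 'I_n -> {RV P >-> R}) (sigma : R)
  (cl : {set 'I_p} -> \bar R) (betabar : 'cV[R]_p) (eta : R) :
  mutually_independent P (fun i => (y i : T -> R)) ->
  (forall i, P.-integrable setT (EFin \o y i)) ->
  0 <= sigma ->
  (forall (i : 'I_n) (t : R),
     ('E_P[fun w => expR (t * (y i w - fine 'E_P[y i]))]
       <= (expR (sigma ^+ 2 * t ^+ 2 / 2))%:E)%E) ->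
  coding_length cl ->
  0 < eta < 1 ->
  let Ey : 'cV[R]_n := \col_i fine 'E_P[y i] in
  let Qhat (w : T) (b : 'cV[R]_p) := norm2 (X *m b - \col_i y i w) ^+ 2 in
  exists E : set T, measurable E /\ ((1 - eta)%:E < P E)%E /\
    forall w, E w ->
    forall (eps : R) (b : 'cV[R]_p), 0 <= eps ->
      Qhat w b <= Qhat w betabar + eps ->
      (cc cl b < +oo)%E ->
      norm2 (X *m b - Ey)
        <= norm2 (X *m betabar - Ey) + sigma * Num.sqrt (2 * ln (6 / eta))
           + 2 * Num.sqrt (74 / 10 * sigma ^+ 2 * fine (cc cl b)
                           + 47 / 10 * sigma ^+ 2 * ln (6 / eta) + eps)
      /\
      (cc_subadditive cl ->
       ((n%:R)%:E * rho_minus X cl (cc cl b + cc cl betabar)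
          * (norm2 (b - betabar) ^+ 2)%:E
        <= (10 * norm2 (X *m betabar - Ey) ^+ 2
            + 37 * sigma ^+ 2 * fine (cc cl b)
            + 29 * sigma ^+ 2 * ln (6 / eta) + 5 / 2 * eps)%:E)%E).
Proof.
move=> indY _ sigma0 subg hcl /andP[eta0 eta1] Ey Qhat.
pose L := ln (6 / eta).
have L0 : 0 <= L by rewrite ln_ge0// ler_pdivlMr//; lra.
have expL : expR (- L) = eta / 6.
  by rewrite expRN lnK ?posrE ?divr_gt0// invf_div.
pose xi w : 'cV[R]_n := (\col_i y i w) - Ey.
have xiE w i : xi w i 0 = y i w - fine 'E_P[y i] by rewrite !mxE.
have mxi i : measurable_fun setT (fun w => xi w i 0).
  by under eq_fun do rewrite xiE; exact: measurable_funB.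
have mgf l : (\int[P]_w (expR (dot l (xi w)))%:E
     <= (expR (sigma ^+ 2 * dot l l / 2))%:E)%E.
  have := @independent_subgaussian_mgf _ _ _ P _ y (fun i => fine 'E_P[y i])
    sigma l indY.
  have -> : dot l l = \sum_i l i 0 ^+ 2 by apply: eq_bigr => i _; rewrite expr2.
  under eq_integral do rewrite /dot (eq_bigr _ (fun i _ => congr1 _ (esym (xiE _ i)))).
  apply => i t; have := subg i t; by rewrite unlock.
(* The two extra vectors bring [u] and [v] into the span. The basis depends on [F] only, not on [w]
   or [b], so finitely many events cover every estimator. *)
pose basis (F : {set 'I_p}) := gram_schmidt ([seq col j X | j <- enum F] ++ [:: Ey; X *m betabar]).
pose us (F : {set 'I_p}) := projT1 (cid (basis F)).
have ous F : orthonormal_seq (us F) by rewrite /us; case: cid => ? [].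
have sus F : (size (us F) <= #|F| + 2)%N.
  rewrite /us; case: cid => /= s [_ + _].
  by rewrite size_cat size_map -cardE.
have spus (F : {set 'I_p}) x : x \in [seq col j X | j <- enum F] ++ [:: Ey; X *m betabar] ->
    spans (us F) x.
  by rewrite /us; case: cid => /= s [_ _]; apply.
(* The direction is the opposite of [v] below, since it is [- dot v (xi w)] that needs an upper
   bound. *)
have [E [mE PE HE]] := @subgaussian_good_event _ _ _ P _ _ xi sigma cl us
  (Ey - X *m betabar) L mxi mgf sigma0 hcl ous sus L0.
exists E; split=> //; split.
  by apply: lt_le_trans PE; rewrite lte_fin expL; lra.
move=> w Ew eps b eps0 Qle ccb.
have [lin quad] := HE w Ew.
(* [F] may vary with [b], hence with the data; this is harmless because the event controls all
   supports at once. *)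
have [F bF ccE] := cc_attained _ _ cl b.
have clF : (cl F < +oo)%E.
  have [_ /(_ F) clF0 _] := hcl.
  by move: ccb clF0; rewrite ccE /cc_set; case: (cl F) => // r _ _; exact: ltry.
set c := fine (cc cl b).
have c0 : 0 <= c.
  rewrite /c ccE; apply: fine_ge0; rewrite adde_ge0//.
  by have [_ + _] := hcl; exact.
have {}quad := quad F clF; rewrite -ccE -/c in quad.
pose u := X *m b - Ey; pose v := X *m betabar - Ey.
have uv : X *m (b - betabar) = u - v.
  by rewrite mulmxBr /u /v opprB addrA subrK.
set Q := \sum_(_ <- us F) _ in quad.
have Q0 : 0 <= Q by apply: sumr_ge0 => i _; exact: sqr_ge0.
pose A := Num.sqrt Q.
have A0 : 0 <= A by exact: sqrtr_ge0.
have A2 : A ^+ 2 = Q by exact: sqr_sqrtr.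
have spcol j : j \in F -> spans (us F) (col j X).
  move=> jF; apply: spus; rewrite mem_cat; apply/orP; left; apply/mapP.
  by exists j; rewrite ?mem_enum.
have spEy : spans (us F) Ey.
  by apply: spus; rewrite mem_cat inE eqxx orbT.
have spXb : spans (us F) (X *m betabar).
  by apply: spus; rewrite mem_cat !inE eqxx !orbT.
have spu : spans (us F) u by exact: spansB _ _ _ (spans_mulmx _ _ _ _ spcol bF) spEy.
have spv : spans (us F) v by exact: spansB _ _ _ spXb spEy.
have basic : dot u u - 2 * dot u (xi w) <= dot v v - 2 * dot v (xi w) + eps.
  move: Qle; rewrite /Qhat !sqr_norm2.
  have yE x : X *m x - \col_i y i w = (X *m x - Ey) - xi w.
    by rewrite /xi opprB addrA subrK.
  by rewrite !yE -/u -/v !dotBB; lra.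
have lin' : - dot v (xi w) <= norm2 v * (sigma * Num.sqrt (2 * L)).
  by rewrite -dotNl opprB -(norm2N _ _ v) opprB.
have uA := @dot_le_spans _ _ _ u (xi w) (ous F) spu.
have dA := @dot_le_spans _ _ _ (u - v) (xi w) (ous F) (spansB _ _ _ spu spv).
rewrite -/Q -/A in uA dA.
have s2 := sqr_ge0 sigma.
have s2c : 0 <= sigma ^+ 2 * c by exact: mulr_ge0.
have s2L : 0 <= sigma ^+ 2 * L by exact: mulr_ge0.
have Qle' : Q <= 5 * (sigma ^+ 2 * c) + 4 * (sigma ^+ 2 * L) by lra.
split.
  apply: (@quadratic_bound _ _ _ _ A eps) => //; rewrite ?norm2_ge0 ?sqrtr_ge0//.
  - by rewrite mulr_ge0 ?sqrtr_ge0.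
  (* The coefficients 5 and 4 in the bound on [A ^+ 2] are below 7.4 and 4.7. *)
  - by rewrite A2 -/L -!mulrA; lra.
  - rewrite !sqr_norm2 -/u -/v -/L; lra.
move=> subadd.
have [F' bF' ccE'] := cc_attained _ _ cl betabar.
(* The union of two optimal supports contains the support of [b - betabar], and sub-additivity
   bounds its complexity by the sum. *)
apply: (le_trans (@rho_minus_mul_le _ _ _ X cl _ (F :|: F') _ _ _)).
- by rewrite ccE ccE'; exact: subadd.
- apply/fintype.subsetP => j; rewrite !inE !mxE => bj.
  case: (boolP (b j 0 == 0)) bj => [/eqP -> |b0 _].
    rewrite add0r oppr_eq0 => b'0; apply/orP; right.
    by apply: (fintype.subsetP bF'); rewrite inE.
  by apply/orP; left; apply: (fintype.subsetP bF); rewrite inE.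
rewrite lee_fin uv -/v.
have dv : dot (u - v) (- v) <= norm2 (u - v) * norm2 v.
  by rewrite -(norm2N _ _ v); exact: dot_le_norm2.
(* Inserting the basic inequality into the expansion of [|u - v|^2] leaves
   [2 <u - v, - v> + 2 <u - v, xi> + eps]. The noise term stays whole, so the linear tail does not
   enter. *)
have basicD : norm2 (u - v) ^+ 2 <= 2 * (norm2 (u - v) * norm2 v) +
    2 * (norm2 (u - v) * A) + eps.
  move: dv dA basic; rewrite sqr_norm2 dotNr.
  rewrite [dot (u - v) v]dotDl [dot (u - v) (xi w)]dotDl !(dotNl v) (dotBB u v); lra.
apply: le_trans (distance_bound _ _ _ _ _ basicD) _.
(* Here [50 / 7 * 5 = 250 / 7 <= 37] and [50 / 7 * 4 = 200 / 7 <= 29]. *)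
by rewrite A2 -/c -/L -!mulrA; lra.
Qed.
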